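(* For any fixed positive integer $k$, there is an algorithm which, for every integer $n>2k$, computes the independence number $\alpha(P(n,k))$ of $P(n,k)$ with running time $O(n)$ (the implied constant depending on $k$).
   Context: For positive integers $n,k$ with $n>2k$, the generalized Petersen graph $P(n,k)$ is the graph with vertex set $\{u_i,v_i : i=1,\dots,n\}$ (so $2n$ vertices) and edge set $\{u_iu_{i+1},\ u_iv_i,\ v_iv_{i+k} : i=1,\dots,n\}$, subscripts being reduced modulo $n$. For a graph $G$, $\alpha(G)$ denotes the independence number, i.e. the size of a largest set of pairwise non-adjacent vertices. *)

(* Defs.v *)
From mathcomp Require Import all_boot.

Set Implicit Arguments.
Unset Strict Implicit.
Unset Printing Implicit Defensive.

Definition independent (T : finType) (e : rel T) (S : {set T}) : bool :=
  [forall x in S, forall y in S, ~~ e x y].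

Definition independence_number (T : finType) (e : rel T) : nat :=
  \max_(S : {set T} | independent e S) #|S|.

(* [inl i] is u_i and [inr i] is v_i; the indices 1, ..., n modulo n are
   represented by their residues 0, ..., n - 1. *)
Definition petersen_vertex (n : nat) : finType := ('I_n + 'I_n)%type.

(* Each edge in the orientation u_i -> u_(i+1), u_i -> v_i, v_i -> v_(i+k). *)
Definition petersen_arc (n k : nat) : rel (petersen_vertex n) :=
  fun x y =>
    match x, y with
    | inl i, inl j => j == i.+1 %% n :> nat
    | inl i, inr j => j == i
    | inr i, inr j => j == (i + k) %% n :> nat
    | inr _, inl _ => false
    end.

Definition petersen (n k : nat) : rel (petersen_vertex n) :=
  fun x y => petersen_arc k x y || petersen_arc k y x.

Lemma petersen_sym (n k : nat) : symmetric (@petersen n k).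
Proof. by move=> x y; rewrite /petersen orbC. Qed.

Lemma petersen_irr (n k : nat) :
  0 < k -> 2 * k < n -> irreflexive (@petersen n k).
Proof.
move=> k_gt0 ltkn.
have neq_mod i d : i < n -> 0 < d < n -> (i == (i + d) %% n) = false.
  move=> ltin /andP[d_gt0 ltdn]; apply/eqP => eq_i.
  have: i + 0 == i + d %[mod n] by rewrite addn0 (modn_small ltin) -eq_i.
  by rewrite eqn_modDl mod0n modn_small // eq_sym (gtn_eqF d_gt0).
have ltkn' : k < n by apply: leq_ltn_trans ltkn; rewrite leq_pmull.
case=> i; rewrite /petersen /petersen_arc orbb; last by rewrite neq_mod ?k_gt0.
by rewrite -addn1 neq_mod //= (leq_ltn_trans k_gt0).
Qed.

(* Computation model: the random access machine of Cook and Reckhow, with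
   natural-number registers R_0, R_1, ..., truncated subtraction, and unit cost
   per instruction.  A program is a fixed finite list of instructions; [m] below
   is a position in that list. *)
Inductive instr : Type :=
| RConst of nat & nat         (* RConst i c : R_i := c *)
| RAdd of nat & nat & nat     (* RAdd i j l : R_i := R_j + R_l *)
| RSub of nat & nat & nat     (* RSub i j l : R_i := R_j - R_l *)
| RLoad of nat & nat          (* RLoad i j : R_i := R_(R_j) *)
| RStore of nat & nat         (* RStore i j : R_(R_i) := R_j *)
| RJump of nat & nat.         (* RJump m j : if R_j > 0, go to m *)

Definition program : Type := seq instr.

Definition memory : Type := nat -> nat.

Definition update (s : memory) (i v : nat) : memory :=
  fun r => if r == i then v else s r.

Record config : Type := Config { pc : nat; regs : memory }.

Definition exec (a : instr) (c : config) : config :=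
  let s := regs c in
  let next s' := Config (pc c).+1 s' in
  match a with
  | RConst i v => next (update s i v)
  | RAdd i j l => next (update s i (s j + s l))
  | RSub i j l => next (update s i (s j - s l))
  | RLoad i j => next (update s i (s (s j)))
  | RStore i j => next (update s (s i) (s j))
  | RJump m j => if 0 < s j then Config m s else next s
  end.

Definition halted (p : program) (c : config) : bool := size p <= pc c.

(* A halted configuration is left unchanged. *)
Definition step (p : program) (c : config) : config :=
  if onth p (pc c) is Some a then exec a c else c.

Definition initial (x : nat) : config := Config 0 (update (fun=> 0) 0 x).

Definition run (p : program) (x t : nat) : config := iter t (step p) (initial x).

(* On input [x] (in R_0), [p] halts after at most [T] instructions with [y] in
   R_0, no register ever holding a value above [W].  The bound [W] is what makes
   the unit cost realistic: when it is polynomial in [x], the machine is a RAM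
   with words of O(log x) bits. *)
Definition computes_within (p : program) (x y T W : nat) : Prop :=
  (exists2 t, t <= T & halted p (run p x t) /\ regs (run p x t) 0 = y) /\
  (forall t r, regs (run p x t) r <= W).

(* Main.v *)
(** A set of vertices is an n-periodic word whose letters are the columns
    (u_t, v_t), and it is independent iff each letter is compatible with the
    next one and with the one k places later.  Independent sets are therefore
    the closed walks of length n in a finite graph whose vertices are windows of
    k consecutive columns, and alpha is the largest weight of such a walk.
    Dynamic programming over the pairs (initial window, current window), which
    are constant in number, finds it in n rounds of constant length.  Each
    instruction in a round at most doubles the largest register, while the
    registers are O(n) at the start of every round; hence the word bound. *)

Require Import Defs.
From mathcomp Require Import all_boot.
From mathcomp Require Import zify.

Set Implicit Arguments.
Unset Strict Implicit.
Unset Printing Implicit Defensive.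

(** * Straight-line code and register bounds *)

(* Constants are at most 2 so that an instruction at most doubles any bound
   [b >= 2] on the registers. *)
Definition arith (a : instr) : bool :=
  match a with
  | RConst _ v => v <= 2
  | RAdd _ _ _ | RSub _ _ _ => true
  | _ => false
  end.

Definition effect (s : memory) (a : instr) : memory := regs (exec a (Config 0 s)).

Definition effects (L : seq instr) (s : memory) : memory := foldl effect s L.

Lemma effects_cat (L1 L2 : seq instr) (s : memory) :
  effects (L1 ++ L2) s = effects L2 (effects L1 s).
Proof. exact: foldl_cat. Qed.

Lemma exec_arith (a : instr) (m : nat) (s : memory) :
  arith a -> exec a (Config m s) = Config m.+1 (effect s a).
Proof. by case: a. Qed.

Lemma effect_bound (a : instr) (s : memory) (b : nat) :
    arith a -> 2 <= b -> (forall r, s r <= b) ->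
  forall r, effect s a r <= 2 * b.
Proof.
move=> ar b2 sb r.
have s2 r' : s r' <= 2 * b by apply: leq_trans (sb r') _; rewrite leq_pmull.
case: a ar => //= [i v|i j l|i j l] v2; rewrite /effect /= /update; case: eqP => // _.
- by apply: leq_trans v2 _; apply: leq_trans b2 _; rewrite leq_pmull.
- by rewrite mul2n -addnn leq_add.
- exact: leq_trans (leq_subr _ _) (s2 j).
Qed.

Lemma effects_bound (L : seq instr) (s : memory) (b : nat) :
    all arith L -> 2 <= b -> (forall r, s r <= b) ->
  forall r, effects L s r <= 2 ^ size L * b.
Proof.
elim: L s b => [|a L IH] s b /=; first by move=> _ _ sb r; rewrite mul1n.
move=> /andP[ar arL] b2 sb r.
rewrite expnSr -mulnA; apply: IH => //; last exact: effect_bound.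
by apply: leq_trans b2 _; rewrite leq_pmull.
Qed.

(** The bound ranges over every intermediate time, because the word size is limited during the
    computation and not only at its end. *)
Definition reaches (p : program) (W : nat) (c : config) (T : nat) (c' : config) :=
  iter T (step p) c = c' /\
  forall t, t <= T -> forall r, regs (iter t (step p) c) r <= W.

Lemma reaches_trans (p : program) (W : nat) (c c' c'' : config) (T T' : nat) :
  reaches p W c T c' -> reaches p W c' T' c'' -> reaches p W c (T + T') c''.
Proof.
move=> [e b] [e' b']; split=> [|t tT r]; first by rewrite addnC iterD e.
have [tT1|/ltnW tT1] := leqP t T; first exact: b.
by rewrite -(subnK tT1) iterD e; apply: b'; rewrite leq_subLR.
Qed.

(** The induction moves the head of [L] to the end of the prefix [A], so the whole program never
    changes. *)
Lemma iter_arith (A L B : seq instr) (s : memory) :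
    all arith L ->
  iter (size L) (step (A ++ L ++ B)) (Config (size A) s)
    = Config (size A + size L) (effects L s).
Proof.
elim: L A s => [|a L IH] A s /=; first by rewrite addn0.
case/andP=> ar arL; rewrite -iterS iterSr /step /=.
rewrite onth_cat ltnn subnn /= exec_arith // -/(step _).
by have := IH (rcons A a) (effect s a) arL; rewrite size_rcons cat_rcons addSnnS.
Qed.

Lemma reaches_arith (A L B : seq instr) (s : memory) (b W : nat) :
    all arith L -> 2 <= b -> (forall r, s r <= b) -> 2 ^ size L * b <= W ->
  reaches (A ++ L ++ B) W (Config (size A) s) (size L)
    (Config (size A + size L) (effects L s)).
Proof.
move=> arL b2 sb bW; split=> [|t tL r]; first exact: iter_arith.
(* The configuration at time t is the one at the end of the block [take t L], so the bound for
   complete blocks applies to it. *)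
have/andP[art ard] : all arith (take t L) && all arith (drop t L).
  by rewrite -all_cat cat_take_drop.
have := iter_arith A (drop t L ++ B) s art.
rewrite (catA (take t L)) cat_take_drop size_takel // => -> /=.
apply: leq_trans (effects_bound art b2 sb r) _; rewrite size_takel //.
by apply: leq_trans bW; rewrite leq_mul2r leq_exp2l ?tL ?orbT.
Qed.

Lemma computes_withinP (p : program) (x y T T' W m : nat) (s : memory) :
    reaches p W (initial x) T' (Config m s) -> T' <= T -> size p <= m -> s 0 = y ->
  computes_within p x y T W.
Proof.
move=> [e b] TT pm sy; split.
  by exists T' => //; rewrite /halted /run e.
move=> t r; have [tT1|/ltnW tT1] := leqP t T'; first exact: b.
rewrite /run -(subnK tT1) iterD e.
(* A halted configuration is a fixed point of [step], so the bound extends to all later times. *)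
have -> : iter (t - T') (step p) (Config m s) = Config m s.
  by elim: (t - T') => //= i ->; rewrite /step /= onth_default.
by rewrite -e b.
Qed.

(* With truncated subtraction, max (R_d, R_e) = R_d + (R_e - R_d). *)
Definition max_into (d e : nat) : seq instr := [:: RSub 2 e d; RAdd d d 2].

Lemma max_intoE (d : nat) (es : seq nat) (s : memory) :
    d != 2 -> 2 \notin es -> d \notin es ->
  let s' := effects (flatten [seq max_into d e | e <- es]) s in
  s' d = maxn (s d) (\max_(e <- es) s e) /\
  forall r, r != d -> r != 2 -> s' r = s r.
Proof.
move=> d2; elim: es s => [|e es IH] s /=; first by rewrite big_nil maxn0.
rewrite !inE !negb_or => /andP[e2 n2] /andP[de nd].
set s1 := effect (effect s (RSub 2 e d)) (RAdd d d 2).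
have s1r r : r != d -> r != 2 -> s1 r = s r.
  by rewrite /s1 /effect /= /update => /negPf-> /negPf->.
have s1d : s1 d = maxn (s d) (s e).
  by rewrite /s1 /effect /= /update !eqxx (negPf d2) maxnE.
have [Hd Hr] := IH s1 n2 nd; split; last first.
  by move=> r rd r2; rewrite Hr // s1r.
rewrite Hd s1d big_cons maxnA; congr maxn; apply: eq_big_seq => e' e'es.
by apply: s1r; [apply: contraNneq nd|apply: contraNneq n2] => <-.
Qed.

(** * Max-plus dynamic programming on the machine *)

Section MaxPlus.

Variables (I : finType) (A : rel I) (wt : I -> nat) (B F : pred I).

(* The summand [2 * n] marks the walks that start in [B]; it plays the role of
   the value minus infinity, since no other walk of length at most [n] reaches
   [2 * n] when the weights are at most 2. *)
Fixpoint best (n t : nat) (i : I) : nat :=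
  if t is t'.+1 then \max_(j | A j i) (best n t' j + wt j)
  else if B i then 2 * n else 0.

(* R_0 counts the remaining rounds, R_1 = 1, R_2 is scratch, R_3 = 2n; [D i]
   holds the value of [i] and [N i] that value plus the weight of [i]. *)
Let D (i : I) : nat := (enum_rank i).*2 + 4.
Let N (i : I) : nat := (enum_rank i).*2 + 5.

Let D_inj : injective D.
Proof. by move=> i j /addIn/double_inj/val_inj/enum_rank_inj. Qed.
Let N_inj : injective N.
Proof. by move=> i j /addIn/double_inj/val_inj/enum_rank_inj. Qed.
Let DN i j : (D i == N j) = false. Proof. by rewrite /D /N; lia. Qed.
Let D_ge4 i : 4 <= D i. Proof. by rewrite /D; lia. Qed.
Let N_ge4 i : 4 <= N i. Proof. by rewrite /N; lia. Qed.

Let init : seq instr :=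
  [:: RConst 1 1; RAdd 3 0 0] ++ [seq RAdd (D i) 3 2 | i <- enum B].
Let add_weights (l : seq I) : seq instr :=
  flatten [seq [:: RConst 2 (wt j); RAdd (N j) (D j) 2] | j <- l].
Let maximize (l : seq I) : seq instr :=
  flatten [seq RConst (D i) 0 ::
               flatten [seq max_into (D i) e | e <- [seq N j | j <- enum I & A j i]]
          | i <- l].
(** Every [N j] is computed before any [D i] is overwritten, so a round reads only values of the
    previous one. Clearing R_2 keeps the scratch value out of the register bound. *)
Let body : seq instr :=
  add_weights (enum I) ++ maximize (enum I) ++ [:: RConst 2 0; RSub 0 0 1].
(** On exit from the loop the counter R_0 is 0 and can accumulate the maximum. Truncated subtraction
    of R_3 removes the mark and sends values up to 2n to 0. *)
Let final : seq instr :=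
  [seq RSub (D i) (D i) 3 | i <- enum F] ++
  flatten [seq max_into 0 e | e <- [seq D i | i <- enum F]].

(** Since R_2 is 0, each addition is a copy of R_3. *)
Let initE (n : nat) (l : seq I) (s : memory) : s 3 = 2 * n -> s 2 = 0 ->
  let s' := effects [seq RAdd (D i) 3 2 | i <- l] s in
  (forall i, s' (D i) = if i \in l then 2 * n else s (D i)) /\
  forall r, (forall i, i \in l -> r != D i) -> s' r = s r.
Proof.
elim: l s => //= i l IH s s3 s2.
have D3 : 3 == D i = false by have := D_ge4 i; lia.
have D2 : 2 == D i = false by have := D_ge4 i; lia.
have [] := IH (effect s (RAdd (D i) 3 2)).
- by rewrite /effect /= /update D3.
- by rewrite /effect /= /update D2.
rewrite /effect /= /update s3 s2 addn0 => HD Hr; split=> [j|r rl].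
  rewrite HD inE (inj_eq D_inj).
  by case: (j \in l); case: eqP.
rewrite Hr ?(negPf (rl i _)) ?mem_head // => j jl.
by apply: rl; rewrite inE jl orbT.
Qed.

Let add_weightsE (l : seq I) (s : memory) :
  let s' := effects (add_weights l) s in
  (forall j, j \in l -> s' (N j) = s (D j) + wt j) /\
  forall r, r != 2 -> (forall j, j \in l -> r != N j) -> s' r = s r.
Proof.
elim: l s => //= i l IH s.
set s1 := effect (effect s (RConst 2 (wt i))) (RAdd (N i) (D i) 2).
have s1E r : r != 2 -> s1 r = if r == N i then s (D i) + wt i else s r.
  rewrite /s1 /effect /= /update => /negPf ->.
  by have -> : D i == 2 = false by have := D_ge4 i; lia.
have [HN Hr] := IH s1; split=> [j|r r2 rl].
  rewrite inE; have [jl _|jl] := boolP (j \in l).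
    by rewrite HN // s1E ?DN //; have := D_ge4 j; lia.
  rewrite orbF => /eqP jE; rewrite -/(add_weights l) Hr ?s1E ?jE ?eqxx //.
  - by have := N_ge4 i; lia.
  - by have := N_ge4 i; lia.
  - by move=> j' j'l; rewrite (inj_eq N_inj); apply: contraNneq jl => e; rewrite jE e.
rewrite Hr // ?s1E // ?(negPf (rl i _)) ?mem_head // => j jl.
by apply: rl; rewrite inE jl orbT.
Qed.

Let maximizeE (l : seq I) (s : memory) :
  let s' := effects (maximize l) s in
  (forall i, i \in l -> s' (D i) = \max_(j | A j i) s (N j)) /\
  forall r, r != 2 -> (forall i, i \in l -> r != D i) -> s' r = s r.
Proof.
elim: l s => //= i l IH s; rewrite -/(maximize l) effects_cat.
set s0 := effect s (RConst (D i) 0).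
set es := [seq N j | j <- enum I & A j i].
have [] := @max_intoE (D i) es s0.
- by have := D_ge4 i; lia.
- by apply/mapP => -[j _]; have := N_ge4 j; lia.
- by apply/mapP => -[j _] /eqP; rewrite DN.
set s1 := effects _ s0; move=> s1D s1r.
have s0r r : r != D i -> s0 r = s r by rewrite /s0 /effect /= /update => /negPf->.
have s0D : s0 (D i) = 0 by rewrite /s0 /effect /= /update eqxx.
have s1N j : s1 (N j) = s (N j).
  by rewrite s1r ?s0r ?[N j == _]eq_sym ?DN //; have := N_ge4 j; lia.
have {}s1D : s1 (D i) = \max_(j | A j i) s (N j).
  rewrite s1D s0D max0n big_map big_filter big_enum_cond /=.
  by apply: eq_bigr => j _; rewrite s0r // eq_sym DN.
have [HD Hr] := IH s1; split=> [j|r r2 rl].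
  rewrite inE; have [jl _|jl] := boolP (j \in l).
    by rewrite HD //; apply: eq_bigr => j' _; rewrite s1N.
  rewrite orbF => /eqP jE; rewrite Hr ?jE //.
  - by have := D_ge4 i; lia.
  - by move=> j' j'l; rewrite (inj_eq D_inj); apply: contraNneq jl => e; rewrite jE e.
rewrite Hr // ?s1r ?s0r ?(rl i) ?mem_head // => j jl.
by apply: rl; rewrite inE jl orbT.
Qed.

(** The subtraction is in place, so [uniq l] ensures that each register undergoes it once. *)
Let finalE (n : nat) (l : seq I) (s : memory) : uniq l -> s 3 = 2 * n ->
  let s' := effects [seq RSub (D i) (D i) 3 | i <- l] s in
  (forall i, i \in l -> s' (D i) = s (D i) - 2 * n) /\
  forall r, (forall i, i \in l -> r != D i) -> s' r = s r.
Proof.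
elim: l s => //= i l IH s /andP[il ul] s3.
have D3 : 3 == D i = false by have := D_ge4 i; lia.
have [//||] := IH (effect s (RSub (D i) (D i) 3)).
  by rewrite /effect /= /update D3.
rewrite /effect /= /update s3 => HD Hr; split=> [j|r rl].
  rewrite inE; have [jl _|jl] := boolP (j \in l).
    rewrite HD // (inj_eq D_inj); case: eqP => // ji.
    by rewrite -ji jl in il.
  rewrite orbF => /eqP jE; rewrite Hr ?jE ?eqxx // => j' j'l.
  by rewrite (inj_eq D_inj); apply: contraNneq jl => e; rewrite jE e.
rewrite Hr ?(negPf (rl i _)) ?mem_head // => j jl.
by apply: rl; rewrite inE jl orbT.
Qed.

Hypothesis wt_le2 : forall i, wt i <= 2.

Let prog : program := init ++ body ++ RJump (size init) 0 :: final.

(** The bound is the initial mark 2n plus at most 2 for each completed round. *)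
Let inv (n t : nat) (s : memory) :=
  [/\ s 0 = n - t, s 1 = 1, s 2 = 0, s 3 = 2 * n &
      (forall i, s (D i) = best n t i) /\ forall r, s r <= 2 * n + 2 * t].

Let arith_init : all arith init.
Proof. by rewrite all_cat /= all_map; apply/allP. Qed.

Let arith_max (d : nat) (es : seq nat) :
  all arith (flatten [seq max_into d e | e <- es]).
Proof. by elim: es. Qed.

Let arith_body : all arith body.
Proof.
rewrite !all_cat /= andbT; apply/andP; split.
  by elim: (enum I) => //= i l ->; rewrite wt_le2.
by elim: {1}(enum I) => //= i l; rewrite all_cat arith_max => ->.
Qed.

Let arith_final : all arith final.
Proof. by rewrite all_cat arith_max andbT all_map; apply/allP. Qed.

Let inv_init (n : nat) : 0 < n -> inv n 0 (effects init (regs (initial n))).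
Proof.
move=> n_gt0; rewrite effects_cat.
set s := effects _ (regs (initial n)).
have sE r : s r = if r == 3 then 2 * n else if r == 1 then 1 else
                  if r == 0 then n else 0.
  by rewrite /s /= /effect /= /update /= addnn mul2n.
have [//|//|HD Hr] := @initE n (enum B) s; rewrite ?sE //.
have small r : r < 4 -> forall i, i \in enum B -> r != D i.
  by move=> r4 i _; have := D_ge4 i; lia.
split; rewrite ?(Hr _ (small _ _)) ?sE ?subn0 //; split=> [i|r].
  rewrite HD mem_enum /in_mem /=; case: (B i) => //.
  by rewrite sE; have := D_ge4 i; case: (D i) => [|[|[|[|]]]].
have sr: s r <= 2 * n + 2 * 0 by rewrite sE; do ![case: eqP => _]; lia.
have [/existsP[i /eqP->]|/existsPn h] := boolP [exists i, r == D i].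
  rewrite HD; case: ifP => _; first lia.
  by rewrite sE; have := D_ge4 i; case: (D i) => [|[|[|[|]]]].
by rewrite Hr.
Qed.

Let inv_body (n t : nat) (s : memory) :
  inv n t s -> inv n t.+1 (effects body s).
Proof.
case=> s0 s1 s2 s3 [sD sb]; rewrite !effects_cat.
have [aN ar] := add_weightsE (enum I) s.
set sa := effects _ s in aN ar *.
have [mD mr] := maximizeE (enum I) sa.
set sm := effects _ sa in mD mr *.
set s' := effects _ sm.
have s'E r : s' r = if r == 0 then sm 0 - sm 1 else if r == 2 then 0 else sm r.
  by rewrite /s' /= /effect /= /update.
have small r : r < 4 -> r != 2 -> sm r = s r.
  by move=> r4 r2; rewrite mr // ?ar // => i _; [have := N_ge4 i|have := D_ge4 i]; lia.
have mDE i : sm (D i) = best n t.+1 i.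
  by rewrite mD ?mem_enum //=; apply: eq_bigr => j _; rewrite aN ?mem_enum // sD.
have s'D i : s' (D i) = best n t.+1 i.
  rewrite s'E; have := D_ge4 i; case: eqP => [->//|_]; case: eqP => [->//|_] _.
  exact: mDE.
have ab r : r != 2 -> sa r <= 2 * n + 2 * t.+1.
  move=> r2; have [/existsP[i /eqP->]|/existsPn h] := boolP [exists i, r == N i].
    by rewrite aN ?mem_enum //; have := sb (D i); have := wt_le2 i; lia.
  by rewrite ar //; have := sb r; lia.
have mb r : r != 2 -> sm r <= 2 * n + 2 * t.+1.
  move=> r2; have [/existsP[i /eqP->]|/existsPn h] := boolP [exists i, r == D i].
    rewrite mD ?mem_enum //; apply/bigmax_leqP => j _; apply: ab.
    by have := N_ge4 j; lia.
  by rewrite mr // ab.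
split; rewrite ?s'E /= ?small //.
  by rewrite s0 s1; lia.
split=> // r; rewrite s'E; case: eqP => [_|_]; first by have := mb 0; lia.
by case: eqP => // /eqP r2; exact: mb.
Qed.

Let effects_final (n : nat) (s : memory) :
  inv n n s -> effects final s 0 = \max_(i | F i) (best n n i - 2 * n).
Proof.
case=> s0 _ _ s3 [sD _]; rewrite effects_cat.
have [fD fr] := finalE (enum_uniq F) s3.
set sf := effects _ s in fD fr *.
have [|||-> _] := @max_intoE 0 [seq D i | i <- enum F] sf => //.
- by apply/mapP => -[j _]; have := D_ge4 j; lia.
- by apply/mapP => -[j _]; have := D_ge4 j; lia.
rewrite fr; last by move=> i _; have := D_ge4 i; lia.
rewrite s0 subnn max0n big_map -[RHS]big_enum /=.
by apply: eq_big_seq => i iF; rewrite fD // sD.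
Qed.

Lemma maxplus_ram :
  exists (p : program) (C d : nat), forall n : nat, 2 < n ->
    computes_within p n (\max_(i | F i) (best n n i - 2 * n)) (C * n) (n ^ d).
Proof.
have size_prog : size prog = size init + size body + 1 + size final.
  have sizeE (a b c : program) x : size (a ++ b ++ x :: c) = size a + size b + 1 + size c.
    by rewrite !size_cat /=; lia.
  exact: sizeE.
(* The [.+1] counts the jump ending each round. A block multiplies its starting bound, at most 4n,
   by at most 2 ^ z; this stays below n ^ (z + 3), as 2 <= n and 4n <= n ^ 3. *)
pose z := size prog; exists prog, (size init + (size body).+1 + size final), (z + 3).
move=> n n2; pose W := n ^ (z + 3).
have [z0 zi zb zf] : [/\ 0 < z, size init <= z, size body <= z & size final <= z].
  by rewrite /z size_prog; move: (size init) (size body) (size final) => a b c; split; lia.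
have boundW (L : program) t : size L <= z -> t <= n -> 2 ^ size L * (2 * n + 2 * t) <= W.
  move=> Lz tn; rewrite /W expnD leq_mul //; last by rewrite !expnS expn0; nia.
  apply: (@leq_trans (2 ^ z)); first by rewrite leq_exp2l.
  by rewrite leq_exp2r // ltnW.
have step1 : reaches prog W (initial n) (size init)
               (Config (size init) (effects init (regs (initial n)))).
  apply: (@reaches_arith [::] init _ _ (2 * n + 2 * 0)) => //.
  - lia.
  - by move=> r; rewrite /= /update; case: eqP; lia.
  - exact: boundW.
have inv_le t s r : t <= n -> inv n t s -> s r <= W.
  move=> tn [_ _ _ _ [_ sb]]; apply: leq_trans (sb r) _.
  by have := boundW [::] t (leq0n z) tn; rewrite expn0 mul1n.
have body1 t s : t < n -> inv n t s ->
    reaches prog W (Config (size init) s) (size body)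
      (Config (size init + size body) (effects body s)).
  move=> tn is_; apply: (@reaches_arith init body _ _ (2 * n + 2 * t)) => //.
  - lia.
  - by case: is_ => _ _ _ _ [].
  - by apply: boundW => //; apply: ltnW.
have jump t s : t < n -> inv n t.+1 s ->
    reaches prog W (Config (size init + size body) s) 1
      (Config (if t.+1 < n then size init else size init + size body + 1) s).
  move=> tn is_.
  have e : step prog (Config (size init + size body) s) =
      Config (if t.+1 < n then size init else size init + size body + 1) s.
    rewrite /step /= /prog catA onth_cat size_cat ltnn subnn /=.
    by case: is_ => -> _ _ _ _; rewrite subn_gt0; case: ifP; rewrite // addn1.
  split=> // -[|[|//]] _ r; first exact: inv_le is_.
  by rewrite [iter _ _ _]e; apply: inv_le is_.
(* The test follows the body, so the claim starts at one completed round; for t = n - 1 the jump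
   falls through. *)
have loop t : t < n -> exists2 s, inv n t.+1 s &
    reaches prog W (initial n) (size init + t.+1 * (size body).+1)
      (Config (if t.+1 < n then size init else size init + size body + 1) s).
  elim: t => [|t IH] tn.
    have is_ : inv n 0 (effects init (regs (initial n))) by apply: inv_init; lia.
    eexists; first exact: inv_body is_.
    rewrite mul1n -addn1; apply: reaches_trans step1 _.
    exact: reaches_trans (body1 _ _ tn is_) (jump _ _ tn (inv_body is_)).
  have [s is_] := IH (ltnW tn); rewrite tn => r.
  eexists; first exact: inv_body is_.
  rewrite mulSn [_.+1 + _]addnC addnA; apply: reaches_trans r _; rewrite -addn1.
  exact: reaches_trans (body1 _ _ tn is_) (jump _ _ tn (inv_body is_)).
have [|s] := loop n.-1; first lia.
rewrite prednK; last by lia.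
rewrite ltnn => is_ r; have r' : reaches prog W
    (Config (size init + size body + 1) s) (size final)
    (Config (size init + size body + 1 + size final) (effects final s)).
  pose pre := init ++ body ++ [:: RJump (size init) 0].
  have preE (a b c e : program) :
      (size (a ++ b ++ c) = size a + size b + size c) *
      ((a ++ b ++ c) ++ e ++ [::] = a ++ b ++ c ++ e).
    by rewrite !size_cat addnA cats0 !catA.
  have progE : pre ++ final ++ [::] = prog := (preE _ _ _ _).2.
  have <- : size pre = size init + size body + 1 := (preE _ _ _ [::]).1.
  have := @reaches_arith pre final [::] s (2 * n + 2 * n) W; rewrite progE; apply=> //.
  - lia.
  - by case: is_ => _ _ _ _ [].
  - exact: boundW.
apply: computes_withinP (reaches_trans r r') _ _ (effects_final _); last exact: is_.
  by nia.
by rewrite size_prog.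
Qed.
End MaxPlus.

(** * Words of columns as walks on windows *)

Section Windows.

(** The graph parameter is [k.+1], which makes the index type of windows nonempty. *)
Variable k : nat.

(* A column is (u_t \in S, v_t \in S). *)
Let column : Type := bool * bool.
Let window : Type := {ffun 'I_k.+1 -> column}.

Definition window_of (x : nat -> column) (t : nat) : window :=
  [ffun i : 'I_k.+1 => x (t + i)].

(** There is one conjunct for each arc leaving the column, so each edge is tested at its source
    only. *)
Definition compatible (c right_c far_c : column) : bool :=
  [&& ~~ (c.1 && right_c.1), ~~ (c.1 && c.2) & ~~ (c.2 && far_c.2)].

(** If [w] starts at t, the two windows together cover t to t + k.+1, hence all the letters that
    compatibility at t involves. *)
Definition follows (w w' : window) : bool :=
  [forall i : 'I_k.+1, forall j : 'I_k.+1, (j == i.+1 :> nat) ==> (w' i == w j)]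
  && compatible (w ord0) (w' ord0) (w' ord_max).

Definition compatible_at (x : nat -> column) (t : nat) : bool :=
  compatible (x t) (x t.+1) (x (t + k.+1)).

Definition occupancy (c : column) : nat := c.1 + c.2.

Lemma occupancy_le2 (c : column) : occupancy c <= 2.
Proof. by case: c => [[] []]. Qed.

Lemma follows_window_of (x : nat -> column) (t : nat) :
  follows (window_of x t) (window_of x t.+1) = compatible_at x t.
Proof.
rewrite /follows /compatible_at !ffunE /= !addn0 addSnnS.
case: forallP => // -[] i; apply/forallP => j; apply/implyP => /eqP ji.
by rewrite !ffunE ji addSnnS.
Qed.

(** Only the last letter of [w] is new, so changing x at t + k.+1 suffices. *)
Lemma extend_window (x : nat -> column) (t : nat) (w : window) :
    follows (window_of x t) w ->
  exists2 x', window_of x' t.+1 = w & forall i, i < t + k.+1 -> x' i = x i.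
Proof.
case/andP=> /forallP shift _.
exists (fun i => if i == t + k.+1 then w ord_max else x i); last first.
  by move=> i; case: eqP => // ->; rewrite ltnn.
apply/ffunP => i; rewrite ffunE addSnnS eqn_add2l eqSS.
case: eqP => [e|/eqP ne]; first by congr (w _); apply: val_inj.
have ltik : i.+1 < k.+1 by rewrite ltnS ltn_neqAle ne -ltnS ltn_ord.
have /forallP/(_ (Ordinal ltik)) := shift i.
by rewrite /= eqxx ffunE => /eqP.
Qed.

Lemma eq_window_of (x x' : nat -> column) (t : nat) :
  (forall i, i <= t + k -> x' i = x i) -> window_of x' t = window_of x t.
Proof. by move=> e; apply/ffunP => i; rewrite !ffunE e // leq_add2l -ltnS. Qed.

(* The first component is the window at time 0, carried along unchanged. *)
Let state : finType := (window * window)%type.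

Definition state_step (s s' : state) : bool := (s.1 == s'.1) && follows s.2 s'.2.
Definition state_weight (s : state) : nat := occupancy (s.2 ord0).
Definition closed_state (s : state) : bool := s.1 == s.2.

Local Notation best := (best state_step state_weight closed_state).

Lemma best_ge (n t : nat) (x : nat -> column) :
    (forall i, i < t -> compatible_at x i) ->
  2 * n + \sum_(i < t) occupancy (x i) <= best n t (window_of x 0, window_of x t).
Proof.
elim: t => [|t IH] ok /=; first by rewrite big_ord0 addn0 /closed_state eqxx.
have A : state_step (window_of x 0, window_of x t) (window_of x 0, window_of x t.+1).
  by rewrite /state_step eqxx follows_window_of ok.
apply: (bigmax_sup (window_of x 0, window_of x t)) => //.
rewrite big_ord_recr /= addnA; apply: leq_add.
  by apply: IH => i /ltnW; apply: ok.
by rewrite /state_weight ffunE addn0.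
Qed.

(** An unmarked walk collects at most 2 per step, which is the first alternative. A marked one is
    turned back into a word, one letter per step. *)
Lemma best_le (n t : nat) (w w' : window) :
  best n t (w, w') <= 2 * t \/
  exists x, [/\ window_of x 0 = w, window_of x t = w',
    forall i, i < t -> compatible_at x i &
    best n t (w, w') <= 2 * n + \sum_(i < t) occupancy (x i)].
Proof.
elim: t w' => [|t IH] w' /=.
  rewrite /closed_state /=; case: eqP => [<-|_]; last by left.
  (* Past position k, [inord] gives a default index; those letters are not constrained yet. *)
  right; exists (fun i => w (inord i)).
  have e : window_of (fun i => w (inord i)) 0 = w.
    by apply/ffunP => i; rewrite ffunE inord_val.
  by rewrite e big_ord0 addn0.
(* The empty maximum 0 falls under the first alternative, and a binary maximum inherits the
   alternative of the argument it equals. *)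
elim/big_ind: _ => [|a b Ha Hb|]; first by left.
  by rewrite /maxn; case: ifP.
case=> _ w1 /andP[/eqP/= -> w1w'].
case: (IH w1) => [le|[x [x0 xt ok le]]].
  by left; rewrite mulnS addnC; apply: leq_add; rewrite ?occupancy_le2.
right; rewrite -xt in w1w'; have [x' xt' xx'] := extend_window w1w'.
have x'E i : i <= t + k -> x' i = x i by move=> ik; rewrite xx' // addnS ltnS.
have x't : window_of x' t = w1 by rewrite -xt; apply: eq_window_of.
exists x'; split=> //.
- by rewrite -x0; apply: eq_window_of => i ik; rewrite x'E // (leq_trans ik) ?leq_add2r.
(* Compatibility at t comes from the new step; for i < t it involves positions up to t + k only,
   where the word is unchanged. *)
- move=> i; rewrite ltnS leq_eqVlt => /orP[/eqP->|it].
    by rewrite -follows_window_of x't xt' -xt.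
  have := ok i it; rewrite /compatible_at !xx' //; lia.
- rewrite big_ord_recr /= addnA; apply: leq_add.
    apply: leq_trans le _; rewrite leq_add2l; apply: leq_sum => i _.
    by rewrite x'E // ltnW // (leq_trans (ltn_ord i)) ?leq_addr.
  by rewrite /state_weight /= -x't ffunE addn0.
Qed.

(** * Independent sets as periodic words *)

Variable n : nat.
Hypothesis ltkn : k.+1 < n.

Let n_gt0 : 0 < n. Proof. exact: leq_ltn_trans ltkn. Qed.

Definition columns_of (S : {set petersen_vertex n}) (t : nat) : column :=
  let i : 'I_n := Ordinal (ltn_pmod t n_gt0) in (inl i \in S, inr i \in S).

Definition set_of (x : nat -> column) : {set petersen_vertex n} :=
  [set a : 'I_n + 'I_n | match a with inl i => (x i).1 | inr i => (x i).2 end].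

Lemma card_columns (S : {set petersen_vertex n}) (x : nat -> column) :
    (forall i : 'I_n, x i = (inl i \in S, inr i \in S)) ->
  #|S| = \sum_(i < n) occupancy (x i).
Proof.
move=> xE; rewrite -sum1_card big_sumType /= big_mkcond [X in _ + X]big_mkcond.
rewrite -big_split; apply: eq_bigr => i _; rewrite xE /occupancy /=.
by case: (_ \in S); case: (_ \in S).
Qed.

Lemma independent_columns (S : {set petersen_vertex n}) (t : nat) :
  independent (@petersen n k.+1) S -> compatible_at (columns_of S) t.
Proof.
move=> /forall_inP indS.
have edge a b : a \in S -> b \in S -> petersen_arc k.+1 a b -> False.
  move=> aS bS ab; have /forall_inP/(_ b bS) := indS a aS.
  by rewrite /petersen ab.
rewrite /compatible_at /compatible /=; apply/and3P; split; apply/negP => /andP[aS bS].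
- by apply: edge aS bS _; rewrite /= -[(t %% n).+1]addn1 modnDml addn1.
- by apply: edge aS bS _; rewrite /= eqxx.
- by apply: edge aS bS _; rewrite /= modnDml.
Qed.

Lemma set_of_independent (x : nat -> column) :
    window_of x 0 = window_of x n -> (forall t, t < n -> compatible_at x t) ->
  independent (@petersen n k.+1) (set_of x).
Proof.
move=> xn ok.
(* Equality of the windows at 0 and n gives periodicity only below n + k.+1, which is as far as arcs
   from positions below n reach. *)
have per m : m < n + k.+1 -> x m = x (m %% n).
  have [mn|nm] := ltnP m n; first by rewrite modn_small.
  move=> mk; have ik : m - n < k.+1 by lia.
  have /ffunP/(_ (Ordinal ik)) := xn; rewrite !ffunE /= subnKC // => <-.
  by rewrite -{2}(subnK nm) modnDr modn_small //; lia.
have arc a b : a \in set_of x -> b \in set_of x -> ~~ petersen_arc k.+1 a b.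
  rewrite !inE; case: a b => [i|i] [j|j] //= xi xj; apply/negP => /eqP ji;
    have /and3P[] := ok i (ltn_ord i).
  - by rewrite [x i.+1]per -?ji ?xi ?xj //; have := ltn_ord i; lia.
  - by rewrite xi -ji xj.
  - by rewrite [x (i + _)]per -?ji ?xi ?xj // ltn_add2r.
apply/forall_inP => a aS; apply/forall_inP => b bS.
by rewrite /petersen negb_or !arc.
Qed.

Lemma independence_number_best :
  independence_number (@petersen n k.+1)
    = \max_(s | closed_state s) (best n n s - 2 * n).
Proof.
apply/eqP; rewrite eqn_leq; apply/andP; split; apply/bigmax_leqP.
  move=> S indS; pose x := columns_of S.
  have x0 : window_of x 0 = window_of x n.
    apply/ffunP => i; rewrite !ffunE /x /columns_of.
    by congr (inl _ \in S, inr _ \in S); apply: val_inj; rewrite /= modnDl.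
  have cl : closed_state (window_of x 0, window_of x n) by rewrite /closed_state x0.
  apply: (bigmax_sup (window_of x 0, window_of x n)) => //.
  have := @best_ge n n x (fun t _ => independent_columns t indS).
  rewrite -(@card_columns S x) => [|i]; first lia.
  have e : Ordinal (ltn_pmod i n_gt0) = i by apply: val_inj; rewrite /= modn_small.
  by rewrite /x /columns_of e.
case=> w _ /eqP/= <-.
(* A value of at most 2n contributes 0 after truncated subtraction; any other comes from a word
   closing up after n steps. *)
case: (best_le n n w w) => [|[x [x0 xn ok le]]]; first by rewrite -subn_eq0 => /eqP->.
have indS : independent (@petersen n k.+1) (set_of x).
  by apply: set_of_independent => //; rewrite x0 xn.
apply: (bigmax_sup (set_of x)) => //.
rewrite (@card_columns _ x) ?leq_subLR // => i.
by rewrite !inE; case: (x i).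
Qed.

End Windows.

Theorem theorem5 (k : nat) (k_gt0 : 0 < k) :
  exists (p : program) (C d : nat), forall n : nat, 2 * k < n ->
    computes_within p n (independence_number (@petersen n k)) (C * n) (n ^ d).
Proof.
case: k k_gt0 => // k _.
(* [closed_state] serves as both start and end condition: the current window is the initial one at
   time 0 and again at time n. *)
have [p [C [d comp]]] := @maxplus_ram _ (@state_step k) (@state_weight k)
  (@closed_state k) (@closed_state k) (fun s => occupancy_le2 _).
exists p, C, d => n ltkn.
by rewrite independence_number_best; [apply: comp; lia|lia].
Qed.
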